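(* Let $t\ge 1$ be an integer and let $p$ be a real number with $0<p\le 1/2$. Let $G$ be a bipartite graph with vertex classes $V_1,V_2$ of sizes $n_1,n_2$ and with edge density $\frac{e(G)}{n_1n_2}$ at least $p$. If $$\min\{n_1,n_2\}\ge 128\,p^{-t},$$ then $G$ contains $K_{t,t}$ as a subgraph.
   Context: Graphs are finite and simple; $e(G)$ is the number of edges of $G$. $K_{t,t}$ is the complete bipartite graph with $t$ vertices in each class; $G$ containing $K_{t,t}$ means there are $t$ vertices in $V_1$ and $t$ vertices in $V_2$ such that each of the former is adjacent to each of the latter. Inequalities comparing the integer class sizes with real thresholds are understood literally, as inequalities of real numbers. *)

(* Defs.v *)
From mathcomp Require Import all_boot all_order all_algebra.
From mathcomp Require Import reals.

Set Implicit Arguments.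
Unset Strict Implicit.
Unset Printing Implicit Defensive.

Record sgraph := SGraph {
  vertex :> finType;
  adj : rel vertex;
  adj_sym : symmetric adj;
  adj_irr : irreflexive adj
}.

Definition edges (G : sgraph) : {set {set G}} :=
  [set E : {set G} | [exists x, exists y, adj x y && (E == [set x; y])]].

(* The classes are allowed to be empty, and isolated vertices belong to one of
   the two classes like any other vertex. *)
Definition bipartition (G : sgraph) (V1 V2 : {set G}) : Prop :=
  [/\ V1 :|: V2 = [set: G], [disjoint V1 & V2] &
      forall x y : G, adj x y ->
        (x \in V1) && (y \in V2) || (x \in V2) && (y \in V1)].

(* Subgraph containment is not required to be induced, but in a bipartite graph
   there are no edges inside A or inside B anyway. *)
Definition contains_Ktt (G : sgraph) (V1 V2 : {set G}) (t : nat) : Prop :=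
  exists A B : {set G},
    [/\ A \subset V1, B \subset V2, #|A| = t, #|B| = t &
        forall x y : G, x \in A -> y \in B -> adj x y].

(* Main.v *)
Require Import Defs.
From mathcomp Require Import all_boot all_order all_algebra.
From mathcomp Require Import reals.
From mathcomp Require Import zify ring lra.
Import Order.TTheory GRing.Theory Num.Theory.
Local Open Scope ring_scope.

(** Dependent choice without the logarithmic losses of plain double counting.

Double counting over t-subsets of V1 finds one whose common neighbourhood has
at least about 128 vertices, which falls short of t once t is large.  The cure
is to pick fewer vertices, but to keep control of the remaining graph, and then
to exchange the two sides.  Say that q-dense sides X and Y are good for
K_{a,b}, with constant K, when |X| >= K q^-b and |Y| >= K q^-a ([ample]).  We
pick a set S of only s = a - l vertices of X, and are left with K_{l,b} to be
found between X \ S and a set M of common neighbours of S.  Two things must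
survive: M must have about |Y| q^s vertices, and its vertices must have degree
about q |X|.  Both come from one elementary fact ([dense_common_nbrs]): the
tangent at q to the function x^s meets the axis at q (1 - 1/s), so that
    x^s [x >= q (1 - 1/s)]
lies above that tangent on the whole half-line, and its average over the
normalised degrees x of Y is still at least q^s.  Hence vertices of degree below
q (1 - 1/s) |X| can be discarded for free, and the only real loss is that the
density q becomes q (1 - 1/s), which multiplies |X| q^b by (1 - 1/s)^b
([ample_reduce]).

For a = b = t this costs a constant factor near e, and 128 becomes at least 31.
Afterwards the exponents are (t, l) with l of order log t.  After an exchange of
sides the next reduction replaces t by a number of order log l, at a cost of
only (1 - 1/s)^l with s close to t, which is 1 - O((log t)/t).  The exponents
decrease like iterated logarithms, so the product of all these factors converges:
starting from 31 the constant stays above 31 - 150/a, where a is the larger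
exponent ([biclique_up_log]).  The number l of vertices postponed is chosen with
2^l >= b^3, so that M is so much larger than b^2 that choosing subsets without
repetition changes the counts by a negligible factor.  As soon as the smaller
exponent b is at most 24 one stops: choosing all a vertices at once leaves more
than 24 common neighbours ([biclique_of_ample]).  Likewise for t <= 124 the
original 128 suffices directly. *)

Set Implicit Arguments.
Unset Strict Implicit.
Unset Printing Implicit Defensive.

(** * Two elementary inequalities *)

(** Convexity: the left-hand side is the tangent of x^(k+1) at r.  It vanishes at
x = r (1 - 1/(k+1)), which is the threshold used for the degrees. *)
Lemma pow_ge_tangent (R : realFieldType) (k : nat) (x r : R) :
  0 <= x -> 0 <= r -> r ^+ k * (k.+1%:R * x - k%:R * r) <= x ^+ k.+1.
Proof.
move=> x0 r0; elim: k => [|k IH].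
  by rewrite expr0 expr1; lra.
rewrite [leRHS]exprS; apply: le_trans (ler_wpM2l x0 IH).
have -> : x * (r ^+ k * (k.+1%:R * x - k%:R * r)) =
  r ^+ k.+1 * (k.+2%:R * x - k.+1%:R * r) + r ^+ k * (k.+1%:R * (x - r) ^+ 2).
  by rewrite exprS; ring.
by rewrite lerDl mulr_ge0 ?exprn_ge0 ?(mulr_ge0 _ (sqr_ge0 _)) ?ler0n.
Qed.

Lemma bernoulli (R : realFieldType) (n : nat) (x : R) :
  x <= 1 -> 1 - n%:R * x <= (1 - x) ^+ n.
Proof.
case: n => [|n] x1; first by rewrite expr0; lra.
have x1' : 0 <= 1 - x by lra.
apply: le_trans (@pow_ge_tangent R n _ 1 x1' ler01).
by rewrite expr1n -natr1; lra.
Qed.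

(** A division-free form of ((d - s) / n)^s <= C(d, s) / C(n, s): the price of
choosing s distinct vertices is that a degree d is replaced by d - s, which is
also the degree that remains after the s chosen vertices are removed. *)
Lemma bin_ratio_ge (n d s : nat) :
  ((d - s) ^ s * 'C(n, s) <= n ^ s * 'C(d, s))%N.
Proof.
rewrite -(leq_pmul2r (fact_gt0 s)) -!mulnA !bin_ffact mulnC [leqRHS]mulnC.
have le_ffact m : (m ^_ s <= m ^ s)%N.
  rewrite ffact_prod -[in leqRHS](card_ord s) -prod_nat_const.
  by apply: leq_prod => i _; apply: leq_subr.
have ge_ffact m : ((m - s) ^ s <= m ^_ s)%N.
  rewrite ffact_prod -[X in (_ ^ X)%N](card_ord s) -prod_nat_const.
  by apply: leq_prod => i _; rewrite leq_sub2l // ltnW.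
by rewrite mulnC [leqRHS]mulnC [leqRHS]mulnC leq_mul.
Qed.

(** * Common neighbourhoods of large degree *)

Section Bipartite.
Context {T1 T2 : finType}.
Implicit Types (e : T1 -> T2 -> bool) (X : {set T1}) (Y : {set T2}).

Definition nbrs e X (y : T2) : {set T1} := [set x in X | e x y].

Definition edge_count e X Y : nat := (\sum_(y in Y) #|nbrs e X y|)%N.

Definition biclique e X Y (a b : nat) : Prop :=
  exists (A : {set T1}) (B : {set T2}), [/\ A \subset X, B \subset Y, #|A| = a, #|B| = b &
                forall x y, x \in A -> y \in B -> e x y].

Lemma sum_common_nbrs e X (H : {set T2}) (s : nat) :
  (\sum_(S : {set T1} | (S \subset X) && (#|S| == s))
      #|[set y in H | S \subset nbrs e X y]| =
   \sum_(y in H) 'C(#|nbrs e X y|, s))%N.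
Proof.
transitivity (\sum_(S : {set T1} | (S \subset X) && (#|S| == s))
    \sum_(y in H) (S \subset nbrs e X y : nat))%N.
  apply: eq_bigr => S _; rewrite -sum1_card big_mkcond [RHS]big_mkcond /=.
  by apply: eq_bigr => y _; rewrite inE; case: (y \in H); case: (_ \subset _).
rewrite exchange_big /=; apply: eq_bigr => y yH.
rewrite -(cards_draws (nbrs e X y) s) -sum1_card.
rewrite big_mkcond [RHS]big_mkcond /=; apply: eq_bigr => S _; rewrite inE.
case: (boolP (S \subset nbrs e X y)) => [Sn|_] /=; last by case: ifP.
suff -> : S \subset X by [].
by apply: subset_trans Sn _; apply/subsetP => x; rewrite inE => /andP[].
Qed.

(** Average, over the s-subsets S of X, the number of common neighbours of S that
lie in the set H of vertices with degree at least r (1 - 1/s) |X| + s.  The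
binomial coefficients are at least the s-th powers of the normalised degrees, and
those powers, restricted to H, dominate the tangent at r; on the complement of H
the tangent is at most 0.  As the average normalised degree is at least r, so is
the average of the tangent at least r^s. *)
Lemma dense_common_nbrs (R : realFieldType) e X Y (s : nat) (q r : R) :
  (0 < s)%N -> q <= 1 -> (0 < #|X|)%N ->
  q * #|X|%:R * #|Y|%:R <= (edge_count e X Y)%:R ->
  r = q - s%:R / #|X|%:R -> 0 <= r ->
  exists (S : {set T1}) (M : {set T2}), [/\ S \subset X, #|S| = s, M \subset Y,
    forall x y, x \in S -> y \in M -> e x y &
    #|Y|%:R * r ^+ s <= #|M|%:R /\
    forall y, y \in M ->
      r * (1 - s%:R^-1) * #|X|%:R <= #|nbrs e X y|%:R - s%:R].
Proof.
case: s => [//|k] _; set s := k.+1 => q1 X0 dens rE r0.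
set n := #|X|; have n0 : 0 < n%:R :> R by rewrite ltr0n.
have s0 : 0 < s%:R :> R by rewrite ltr0n.
have s_le_n : (s <= n)%N.
  rewrite -(ler_nat R).
  have : s%:R / n%:R <= 1 :> R by move: rE r0 q1; rewrite -/n; lra.
  by rewrite ler_pdivrMr // mul1r.
pose lam := r * (1 - s%:R^-1).
have lam0 : 0 <= lam.
  by rewrite mulr_ge0 // subr_ge0 invf_le1 // ler1n.
pose H := [set y in Y | lam * n%:R <= #|nbrs e X y|%:R - s%:R].
pose F (S : {set T1}) := [set y in H | S \subset nbrs e X y].
have key : 'C(n, s)%:R * (#|Y|%:R * r ^+ s) <=
    \sum_(S : {set T1} | (S \subset X) && (#|S| == s)) #|F S|%:R.
  rewrite -natr_sum sum_common_nbrs natr_sum.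
  (* The degree of y, less the s chosen vertices, relative to |X|. *)
  pose x y : R := (#|nbrs e X y|%:R - s%:R) / n%:R.
  have avg : r * #|Y|%:R <= \sum_(y in Y) x y.
    rewrite -mulr_suml sumrB sumr_const -[s%:R *+ _]mulr_natr.
    rewrite ler_pdivlMr // rE -/n.
    have -> : (q - s%:R / n%:R) * #|Y|%:R * n%:R =
      q * n%:R * #|Y|%:R - s%:R * #|Y|%:R by field; rewrite gt_eqF.
    by rewrite lerB // -natr_sum.
  have pow_le y : y \in H -> 'C(n, s)%:R * x y ^+ s <= 'C(#|nbrs e X y|, s)%:R.
    rewrite inE => /andP[_ Hy].
    have sd : (s <= #|nbrs e X y|)%N.
      rewrite -(ler_nat R) -subr_ge0; apply: le_trans Hy.
      by rewrite mulr_ge0 // ltW.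
    rewrite /x -natrB // expr_div_n mulrA ler_pdivrMr ?exprn_gt0 //.
    by rewrite -!natrX -!natrM ler_nat mulnC [leqRHS]mulnC bin_ratio_ge.
  have: 'C(n, s)%:R * (#|Y|%:R * r ^+ s) <=
         \sum_(y in H) 'C(n, s)%:R * x y ^+ s.
    rewrite -mulr_sumr ler_wpM2l //.
    (* Here s = k + 1, and the summand is the tangent at r evaluated at x y. *)
    have tangent : #|Y|%:R * r ^+ s <=
        \sum_(y in Y) r ^+ k * (s%:R * x y - k%:R * r).
      rewrite -mulr_sumr sumrB -mulr_sumr sumr_const -[k%:R * r *+ _]mulr_natr.
      rewrite exprSr mulrC -[leLHS]mulrA ler_wpM2l ?exprn_ge0 //.
      apply: le_trans (_ : s%:R * (r * #|Y|%:R) - k%:R * r * #|Y|%:R <= _).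
        by rewrite /s -natr1; lra.
      by rewrite lerB // ler_wpM2l // ltW.
    apply: le_trans tangent _.
    rewrite (bigID (fun y => y \in H)) /=.
    rewrite -[leRHS]addr0; apply: lerD.
      rewrite (eq_bigl (fun y => y \in H)); last first.
        by move=> y; rewrite inE; case: (y \in Y).
      apply: ler_sum => y; rewrite inE => /andP[_ Hy].
      apply: pow_ge_tangent => //; apply: divr_ge0; last exact: ltW.
      by apply: le_trans Hy; rewrite mulr_ge0 // ltW.
    apply: sumr_le0 => y /andP[yY]; rewrite inE yY /= -ltNge => Hy.
    rewrite mulr_ge0_le0 ?exprn_ge0 // subr_le0.
    have: x y <= lam by rewrite /x ler_pdivrMr // ltW.
    move/(ler_wpM2l (ltW s0)) => /le_trans; apply.
    rewrite /lam mulrCA mulrBr mulr1 divff ?gt_eqF //.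
    by rewrite /s -natr1 addrK mulrC.
  by move=> /le_trans; apply; apply: ler_sum.
case: (boolP [exists S : {set T1}, [&& S \subset X, #|S| == s &
          #|Y|%:R * r ^+ s <= #|F S|%:R]]).
  case/existsP=> S /and3P[SX /eqP Ss FS]; exists S, (F S); split => //.
  - by apply/subsetP => y; rewrite !inE => /andP[/andP[]].
  - move=> x y xS; rewrite inE => /andP[_ /subsetP/(_ _ xS)].
    by rewrite inE => /andP[].
  - by split=> // y; rewrite !inE => /andP[/andP[]].
rewrite negb_exists => /forallP noS; exfalso.
move: key; rewrite leNgt => /negP; apply.
have : (0 < #|[set S : {set T1} | (S \subset X) && (#|S| == s)]|)%N.
  by rewrite cards_draws bin_gt0.
move=> /card_gt0P[S0]; rewrite inE => S0P.
apply: lt_le_trans (_ : \sum_(S : {set T1} | (S \subset X) && (#|S| == s))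
         #|Y|%:R * r ^+ s <= _); last first.
  by rewrite sumr_const -cards_draws cardsE -[leLHS]mulr_natl.
apply: ltr_sum => [|S SP].
  by apply/hasP; exists S0; rewrite // mem_index_enum.
by have := noS S; rewrite andbA SP /= -ltNge.
Qed.


Lemma edge_count_flip e X Y :
  (\sum_(x in X) #|[set y in Y | e x y]| = edge_count e X Y)%N.
Proof.
transitivity (\sum_(x in X) \sum_(y in Y) (e x y : nat))%N.
  apply: eq_bigr => x _; rewrite -sum1_card big_mkcond [RHS]big_mkcond /=.
  by apply: eq_bigr => y _; rewrite inE; case: (y \in Y); case: (e x y).
rewrite exchange_big /=; apply: eq_bigr => y _.
rewrite -sum1_card big_mkcond [RHS]big_mkcond /=.
by apply: eq_bigr => x _; rewrite inE; case: (x \in X); case: (e x y).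
Qed.

(** * Choosing part of one side *)

(** The bound q <= 1/2 is a bound on the parameter, not on the true density; it
makes q^-b at least 2^b. *)
Definition ample (R : realFieldType) e X Y (a b : nat) (q K : R) : Prop :=
  [/\ 0 < q <= 1 / 2, q * #|X|%:R * #|Y|%:R <= (edge_count e X Y)%:R,
      K <= #|X|%:R * q ^+ b & K <= #|Y|%:R * q ^+ a].

(** The relative error s / |X| caused by choosing distinct vertices: it is
negligible because |X| >= K q^-b >= K 2^b / (2 q) is exponential in b. *)
Lemma ample_loss (R : realFieldType) e X Y (a b s : nat) (q K eta : R) :
  ample e X Y a b q K -> (0 < b)%N -> 0 < K -> (s <= a)%N ->
  2 * a%:R <= eta * (K * 2 ^+ b) ->
  (0 < #|X|)%N /\ s%:R / #|X|%:R <= q * eta.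
Proof.
move=> [/andP[q0 q12] _ KX _] b0 K0 sa etaP.
have X0 : (0 < #|X|)%N.
  rewrite lt0n; apply/eqP => X0.
  by move: KX; rewrite X0 mul0r leNgt K0.
split=> //; have n0 : 0 < #|X|%:R :> R by rewrite ltr0n.
rewrite ler_pdivrMr //.
have p0 : 0 < 2 ^+ b :> R by rewrite exprn_gt0 // ltr0n.
have eta0 : 0 <= eta.
  rewrite -(pmulr_lge0 _ (mulr_gt0 K0 p0)).
  by apply: le_trans etaP; rewrite mulr_ge0.
have pow : q ^+ b * 2 ^+ b <= 2 * q.
  rewrite -(prednK b0) !exprS.
  have: (q * 2) ^+ b.-1 <= 1 by apply: exprn_ile1; lra.
  rewrite exprMn => /(ler_wpM2l (ltW q0)) h.
  by move: h; rewrite mulr1; set u := q ^+ _; set v := 2 ^+ _; lra.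
have: eta * (K * 2 ^+ b) <= eta * (#|X|%:R * (2 * q)).
  apply: ler_wpM2l => //.
  apply: le_trans (_ : (#|X|%:R * q ^+ b) * 2 ^+ b <= _).
    by apply: ler_wpM2r => //; apply: ltW.
  by rewrite -mulrA; apply: ler_wpM2l => //; apply: ltW.
have : s%:R <= a%:R :> R by rewrite ler_nat.
lra.
Qed.

(** Plain double counting: all a vertices are chosen at once, and when K is large
enough, b of their common neighbours complete the biclique.  The subtracted term
is the loss K a eta, with eta the relative error of distinct choices. *)
Lemma biclique_of_ample (R : realFieldType) e X Y (a b : nat) (q K : R) :
  ample e X Y a b q K -> (0 < a)%N -> (0 < b)%N -> 0 < K ->
  b%:R - 1 < K - 2 * a%:R ^+ 2 / 2 ^+ b ->
  biclique e X Y a b.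
Proof.
move=> amp a0 b0 K0 bK.
have p0 : 0 < 2 ^+ b :> R by rewrite exprn_gt0 // ltr0n.
pose eta : R := 2 * a%:R / (K * 2 ^+ b).
have Kp0 : 0 < K * 2 ^+ b by rewrite mulr_gt0.
have etaP : 2 * a%:R <= eta * (K * 2 ^+ b) by rewrite /eta divfK // gt_eqF.
have [X0 loss] := ample_loss amp b0 K0 (leqnn a) etaP.
have aeta : K * (a%:R * eta) = 2 * a%:R ^+ 2 / 2 ^+ b.
  by rewrite /eta; field; rewrite !gt_eqF.
have a1 : 1 <= a%:R :> R by rewrite ler1n.
have b1 : 1 <= b%:R :> R by rewrite ler1n.
have eta0 : 0 <= eta by rewrite divr_ge0 // ?ltW // mulr_gt0 // ltr0n.
have eta1 : eta <= 1.
  have: a%:R * eta < 1 by rewrite -(ltr_pM2l K0) mulr1; lra.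
  by have := ler_wpM2r eta0 a1; lra.
case: amp => /andP[q0 q12] dens KX KY.
have [||S [M [SX Sa MY SM [Mbig _]]]] :=
    @dense_common_nbrs R e X Y a q _ a0 _ X0 dens erefl.
- lra.
- have := ler_wpM2l (ltW q0) eta1; lra.
have bM : (b <= #|M|)%N.
  rewrite -ltnS -(ltr_nat R) -[X in _ < X]natr1 -ltrBlDr.
  apply: lt_le_trans Mbig; apply: lt_le_trans bK _.
  rewrite -aeta; apply: le_trans (_ : K * (1 - eta) ^+ a <= _).
    rewrite -[K in K - _]mulr1 -mulrBr; apply: ler_wpM2l (ltW K0) _ _ _.
    exact: bernoulli.
  apply: le_trans (ler_wpM2r _ KY) _; first by rewrite exprn_ge0 ?subr_ge0.
  rewrite -mulrA -exprMn ler_wpM2l // lerXn2r ?nnegrE //.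
  - by rewrite mulr_ge0 ?subr_ge0 // ltW.
  - by have := ler_wpM2l (ltW q0) eta1; lra.
  - lra.
have [B BM Bb] : exists2 B : {set T2}, B \subset M & #|B| = b.
  have: (0 < #|[set B : {set T2} | (B \subset M) && (#|B| == b)]|)%N.
    by rewrite cards_draws bin_gt0.
  by case/card_gt0P => B; rewrite inE => /andP[BM /eqP Bb]; exists B.
exists S, B; split => //; first exact: subset_trans MY.
by move=> x y xS /(subsetP BM); apply: SM.
Qed.

(** The reduction from K_{s+l,b} to K_{l,b}.  The density parameter becomes
r (1 - 1/s), where r >= q (1 - eta) takes distinctness into account.  For M the
exponents add up to (s + l) in r and to l in 1 - 1/s; for X \ S they are b in both,
with one more factor 1 - eta for the removal of S.  Since l <= b <= s + l, one
constant serves for both. *)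
Lemma ample_reduce (R : realFieldType) e X Y (s l b : nat) (q K K' eta : R) :
  ample e X Y (s + l) b q K -> (1 < s)%N -> (0 < b)%N -> (l <= b <= s + l)%N ->
  0 < K -> 2 * (s + l)%:R <= eta * (K * 2 ^+ b) -> eta < 1 ->
  K' <= K * (1 - eta) ^+ (s + l).+1 * (1 - s%:R^-1) ^+ b ->
  exists X' M q', ample e X' M l b q' K' /\
    (biclique e X' M l b -> biclique e X Y (s + l) b).
Proof.
move=> amp s1 b0 /andP[lb ba] K0 etaP eta1 KK'.
have [X0 loss] := ample_loss amp b0 K0 (leq_addr l s) etaP.
case: amp => /andP[q0 q12] dens KX KY.
set n : R := #|X|%:R in loss dens KX *.
have n0 : 0 < n by rewrite ltr0n.
have s0 : 0 < s%:R :> R by rewrite ltr0n ltnW.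
pose r := q - s%:R / n.
have rge : q * (1 - eta) <= r by rewrite /r; lra.
have eta0 : 0 <= eta.
  have: 0 < s%:R / n by rewrite divr_gt0.
  by move=> h; rewrite -(pmulr_rge0 _ q0); lra.
have r0 : 0 < r by apply: lt_le_trans rge; rewrite mulr_gt0 // subr_gt0.
have rq : r <= q by rewrite /r gerBl divr_ge0 // ltW.
have z0 : 0 < 1 - s%:R^-1 :> R by rewrite subr_gt0 invf_lt1 // ltr1n.
have z1 : 1 - s%:R^-1 <= 1 :> R by rewrite gerBl invr_ge0 ltW.
have e0 : 0 < 1 - eta by rewrite subr_gt0.
have e1 : 1 - eta <= 1 by rewrite gerBl.
have [|||S [M [SX Ss MY SM [Mbig Mdeg]]]] :=
    @dense_common_nbrs R e X Y s q r _ _ X0 dens erefl.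
- exact: ltnW.
- lra.
- exact: ltW.
set z : R := 1 - s%:R^-1 in z0 z1 Mdeg KK'.
have cX' : #|X :\: S|%:R = n - s%:R :> R.
  rewrite cardsD (setIidPr SX) Ss natrB // -Ss; exact: subset_leq_card.
exists (X :\: S), M, (r * z); split; last first.
  case=> A [B [AX BM Aa Bb AB]]; exists (S :|: A), B; split => //.
  - rewrite subUset SX; apply: subset_trans AX _; exact: subsetDl.
  - exact: subset_trans MY.
  - rewrite cardsU Ss Aa; suff -> : S :&: A = set0 by rewrite cards0 subn0.
    apply/setP => x; rewrite !inE; apply/negP => /andP[xS /(subsetP AX)].
    by rewrite inE xS.
  - move=> x y; rewrite inE => /orP[xS yB|]; last exact: AB.
    by apply: SM => //; apply: (subsetP BM).
have qz0 : 0 < r * z by rewrite mulr_gt0.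
split.
- rewrite qz0 /=; have := ler_wpM2l (ltW r0) z1; lra.
- rewrite cX' natr_sum; apply: le_trans (_ : \sum_(y in M) r * z * (n - s%:R) <= _).
    by rewrite sumr_const mulr_natr.
  apply: ler_sum => y yM.
  have -> : nbrs e (X :\: S) y = nbrs e X y :\: S.
    by apply/setP => x; rewrite !inE; case: (x \in S).
  have dle : #|nbrs e X y|%:R - s%:R <= #|nbrs e X y :\: S|%:R :> R.
    rewrite lerBlDr -natrD ler_nat -(cardsID S (nbrs e X y)) addnC leq_add2l.
    by rewrite -Ss subset_leq_card // subsetIr.
  apply: le_trans (le_trans (Mdeg y yM) dle).
  by apply: ler_wpM2l (ltW qz0) _ _ _; rewrite gerBl ltW.
- rewrite cX'; apply: le_trans KK' _.
  rewrite exprMn mulrA ler_wpM2r ?exprn_ge0 ?(ltW z0) //.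
  have nle : n * (1 - eta) <= n - s%:R.
    rewrite mulrBr mulr1 lerB // mulrC -ler_pdivrMr //.
    by apply: le_trans loss _; have := ler_wpM2r eta0 q12; lra.
  apply: le_trans (_ : K * (1 - eta) ^+ b.+1 <= _).
    by rewrite ler_wpM2l ?(ltW K0) // ler_wiXn2l ?(ltW e0) // ltnS.
  apply: le_trans (ler_wpM2r _ KX) _; first by rewrite exprn_ge0 ?(ltW e0).
  have -> : n * q ^+ b * (1 - eta) ^+ b.+1 =
            n * (1 - eta) * (q * (1 - eta)) ^+ b by rewrite exprS exprMn; ring.
  apply: ler_pM => //.
  - by rewrite mulr_ge0 // ltW.
  - by rewrite exprn_ge0 // mulr_ge0 // ltW.
  - by rewrite lerXn2r ?nnegrE ?mulr_ge0 // ltW.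
- apply: le_trans KK' _.
  rewrite exprMn mulrA.
  apply: ler_pM.
  + by rewrite mulr_ge0 ?exprn_ge0 // ltW.
  + by rewrite exprn_ge0 // ltW.
  + apply: le_trans (ler_wpM2r _ Mbig); last by rewrite exprn_ge0 // ltW.
    rewrite -mulrA -exprD.
    apply: le_trans (_ : K * (1 - eta) ^+ (s + l) <= _).
      by rewrite ler_wpM2l ?(ltW K0) // ler_wiXn2l ?(ltW e0).
    apply: le_trans (ler_wpM2r _ KY) _; first by rewrite exprn_ge0 ?(ltW e0).
    by rewrite -mulrA -exprMn ler_wpM2l // lerXn2r ?nnegrE ?mulr_ge0 ?(ltW q0, ltW e0, ltW r0).
  + exact: (ler_wiXn2l (ltW z0) z1 lb).
Qed.

End Bipartite.

(** * Exponential growth against powers *)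

Lemma pow_succ_le_double (c d k n : nat) :
  (0 < c -> c * n.+1 <= d * n -> d ^ k <= 2 * c ^ k -> n.+1 ^ k <= 2 * n ^ k)%N.
Proof.
move=> c0 cd dk; rewrite -(@leq_pmul2l (c ^ k)) ?expn_gt0 ?c0 //.
rewrite -expnMn; apply: leq_trans (_ : (d * n) ^ k <= _)%N.
  by case: k {dk} => [|k]; rewrite ?expn0 // leq_exp2r.
by rewrite expnMn mulnCA mulnA leq_mul.
Qed.

Lemma sqr_le_pow2 (n : nat) : (n ^ 2 <= 2 * 2 ^ n)%N.
Proof.
have [|n3] := leqP n 3; first by case: n => [|[|[|[|]]]].
elim: n n3 => // n IH; rewrite ltnS leq_eqVlt => /orP[/eqP <- //|n3].
rewrite (expnS 2); have := IH n3.
suff: (n.+1 ^ 2 <= 2 * n ^ 2)%N by lia.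
by apply: (@pow_succ_le_double 3 4); lia.
Qed.

Lemma cube_le_pow2 (n : nat) : (25 <= n -> n ^ 3 <= 2 ^ n)%N.
Proof.
elim: n => // n IH; rewrite leq_eqVlt => /orP[/eqP <-|]; first by lia.
rewrite ltnS => n25; rewrite (expnS 2); have := IH n25.
suff: (n.+1 ^ 3 <= 2 * n ^ 3)%N by lia.
by apply: (@pow_succ_le_double 8 9); lia.
Qed.

Lemma pow6_le_pow2 (n : nat) : (24 <= n -> n.+1 ^ 6 <= 27 * 2 ^ n)%N.
Proof.
elim: n => // n IH; rewrite leq_eqVlt => /orP[/eqP <-|]; first by lia.
rewrite ltnS => n24; rewrite (expnS 2); have := IH n24.
suff: (n.+2 ^ 6 <= 2 * n.+1 ^ 6)%N by lia.
by apply: (@pow_succ_le_double 25 26); lia.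
Qed.

Lemma cube_affine_le_pow2 (n : nat) :
  (21 <= n -> (32 * n + 207) ^ 3 <= 343 * 2 ^ n)%N.
Proof.
elim: n => // n IH; rewrite leq_eqVlt => /orP[/eqP <-|]; first by lia.
rewrite ltnS => n21; rewrite (expnS 2); have := IH n21.
suff: ((32 * n.+1 + 207) ^ 3 <= 2 * (32 * n + 207) ^ 3)%N by lia.
rewrite -(@leq_pmul2l (20 ^ 3)); last by lia.
rewrite -expnMn.
apply: leq_trans (_ : (21 * (32 * n + 207)) ^ 3 <= _)%N.
  by rewrite leq_exp2r //; lia.
by rewrite expnMn mulnA leq_mul2r; apply/orP; right; lia.
Qed.

(** By minimality of b, 2^(b-1) < a^3; so 3 a < b^2 would give 27 2^(b-1) < b^6,
which fails from b = 25 on. *)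
Lemma up_log_cube_sqr (a : nat) (b := up_log 2 (a ^ 3)) :
  (1 < a -> 25 <= b -> b ^ 2 <= 3 * a)%N.
Proof.
move=> a1 b25; have a3 : (1 < a ^ 3)%N by rewrite (@ltn_exp2r 1 a 3).
have := up_log_gtn (isT : 1 < 2)%N a3; rewrite -/b => ub.
rewrite leqNgt; apply/negP => ab.
have b24 : (24 <= b.-1)%N by lia.
have := pow6_le_pow2 b24; rewrite prednK ?(leq_trans _ b25) //.
rewrite leqNgt => /negP; apply.
have: ((3 * a) ^ 3 < (b ^ 2) ^ 3)%N by rewrite ltn_exp2r.
rewrite -expnM expnMn => /(leq_ltn_trans _); apply.
by rewrite leq_mul2l (ltnW ub).
Qed.

(** The bound says that 25 (t + 7) <= 32 (t - l), which is what the first reduction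
needs to compare (1 - 1/(t - l))^t with a constant. *)
Lemma up_log_cube_affine (t : nat) (l := up_log 2 (t ^ 3)) :
  (125 <= t -> 32 * l + 175 <= 7 * t)%N.
Proof.
move=> t125; have t3 : (1 < t ^ 3)%N by rewrite (@ltn_exp2r 1 t 3) //; lia.
have := up_log_gtn (isT : 1 < 2)%N t3; rewrite -/l => ub.
have [l21|l22] := leqP l 21; first by lia.
rewrite leqNgt; apply/negP => tl.
have l21 : (21 <= l.-1)%N by lia.
have := cube_affine_le_pow2 l21; rewrite leqNgt => /negP; apply.
have: ((7 * t) ^ 3 < (32 * l.-1 + 207) ^ 3)%N by rewrite ltn_exp2r //; lia.
rewrite expnMn => /(leq_ltn_trans _); apply.
by rewrite leq_mul2l (ltnW ub) orbT.
Qed.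

(** * Alternating the sides *)

Lemma biclique_flip (T1 T2 : finType) (e : T1 -> T2 -> bool) X Y (a b : nat) :
  biclique (fun y x => e x y) Y X b a -> biclique e X Y a b.
Proof.
by case=> B [A [BY AX Bb Aa AB]]; exists A, B; split=> // x y xA /AB; apply.
Qed.

Lemma ample_flip (R : realFieldType) (T1 T2 : finType) (e : T1 -> T2 -> bool)
    X Y (a b : nat) (q K : R) :
  ample e X Y a b q K -> ample (fun y x => e x y) Y X b a q K.
Proof.
case=> q0 dens KX KY; split => //.
by rewrite /edge_count /nbrs edge_count_flip mulrAC.
Qed.

(** Both powers P and Q lie below 1, so that (1 - P) (1 - Q) >= 0 turns two
applications of Bernoulli into P Q >= P + Q - 1. *)
Lemma bernoulli_mul (R : realFieldType) (m n : nat) (x y : R) :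
  0 <= x <= 1 -> 0 <= y <= 1 ->
  1 - m%:R * x - n%:R * y <= (1 - x) ^+ m * (1 - y) ^+ n.
Proof.
move=> /andP[x0 x1] /andP[y0 y1].
have := @bernoulli _ m _ x1; have := @bernoulli _ n _ y1.
have: (1 - x) ^+ m <= 1 by rewrite exprn_ile1 //; lra.
have: (1 - y) ^+ n <= 1 by rewrite exprn_ile1 //; lra.
set P := _ ^+ m; set Q := _ ^+ n => Q1 P1 hQ hP.
have: 0 <= (1 - P) * (1 - Q) by rewrite mulr_ge0 // subr_ge0.
lra.
Qed.

(** Strong induction on a.  The constant 31 - 150/a may drop to 31 - 150/b when the
larger exponent drops from a to b; as b^2 <= 3 a, the allowance 150 (1/b - 1/a) is of
order 1/b, which also bounds the loss b / s of the reduction, since s is close to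
a.  At the end of the induction a >= 25 keeps the constant at least 25, which beats
b <= 24. *)
Lemma biclique_up_log (R : realFieldType) (a : nat) (T1 T2 : finType)
    (e : T1 -> T2 -> bool) X Y (q : R) (b := up_log 2 (a ^ 3)) :
  (25 <= a)%N -> ample e X Y a b q (31 - 150 / a%:R) -> biclique e X Y a b.
Proof.
rewrite /b {b}.
elim/ltn_ind: a T1 T2 e X Y q => a IH T1 T2 e X Y q a25.
set b := up_log 2 (a ^ 3) => amp.
have a25r : 25 <= a%:R :> R by rewrite (ler_nat R 25).
have a0 : 0 < a%:R :> R by lra.
have ab : (a ^ 3 <= 2 ^ b)%N by apply: up_logP.
have abr : a%:R ^+ 3 <= 2 ^+ b :> R by rewrite -!natrX ler_nat.
have p0 : 0 < 2 ^+ b :> R by rewrite exprn_gt0 // ltr0n.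
have b0 : (0 < b)%N by rewrite up_log_gt0 /= (@ltn_exp2r 1 a 3) //; lia.
set K : R := 31 - 150 / a%:R in amp.
have K25 : 25 <= K.
  have: 150 / a%:R <= 6 :> R by rewrite ler_pdivrMr //; lra.
  by rewrite /K; lra.
have K0 : 0 < K by lra.
(* This is where a^3 <= 2^b is used. *)
have small : 2 * a%:R ^+ 2 / 2 ^+ b <= 2 / a%:R :> R.
  rewrite ler_pdivrMr // mulrAC ler_pdivlMr // -mulrA -exprSr.
  by rewrite ler_pM2l.
have [b24|b25] := leqP b 24.
  apply: (biclique_of_ample amp) => //; first by lia.
  have : b%:R <= 24 :> R by rewrite (ler_nat R b 24).
  have : 2 / a%:R <= 2 / 25 :> R.
    by rewrite ler_pdivrMr // mulrAC ler_pdivlMr //; lra.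
  lra.
have b2a : (b ^ 2 <= 3 * a)%N.
  by apply: up_log_cube_sqr b25; apply: leq_trans a25.
have b25a : (25 * b <= 3 * a)%N.
  by apply: leq_trans b2a; rewrite expnS expn1 leq_mul.
have ba : (b < a)%N by lia.
set l := up_log 2 (b ^ 3).
have lb : (l <= b)%N by apply: up_log_min => //; apply: cube_le_pow2.
have s_gt1 : (1 < a - l)%N by clear -lb b25a b25; lia.
have las : ((a - l) + l = a)%N by clear -lb ba; lia.
set s := (a - l)%N in las s_gt1.
have b25r : 25 <= b%:R :> R by rewrite (ler_nat R 25).
have sr : a%:R - b%:R <= s%:R :> R.
  by rewrite lerBlDr -natrD ler_nat -las leq_add2l.
have b2ar : b%:R ^+ 2 <= 3 * a%:R :> R by rewrite -natrX -natrM ler_nat.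
have s0 : 0 < s%:R :> R by nra.
pose eta : R := 2 * a%:R / (K * 2 ^+ b).
have Kp0 : 0 < K * 2 ^+ b by rewrite mulr_gt0.
have etaP : 2 * a%:R <= eta * (K * 2 ^+ b) by rewrite /eta divfK // gt_eqF.
have Keta : K * ((a.+1)%:R * eta) <= (2 + 2 / 25) / a%:R :> R.
  have -> : K * ((a.+1)%:R * eta) =
     2 * a%:R ^+ 2 / 2 ^+ b * (1 + a%:R^-1).
    by rewrite -natr1 /eta; field; rewrite !gt_eqF.
  have i25 : a%:R^-1 <= 1 / 25 :> R.
    by rewrite -[a%:R^-1]mul1r ler_pdivrMr // mulrAC ler_pdivlMr //; lra.
  have i0 : 0 < a%:R^-1 :> R by rewrite invr_gt0.
  apply: le_trans (ler_wpM2r _ small) _; first by lra.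
  by nra.
have eta0 : 0 <= eta by rewrite divr_ge0 // ?ltW // mulr_gt0 // ltr0n.
have eta1 : eta < 1.
  have h1 : (2 + 2 / 25) / a%:R <= 1 :> R by rewrite ler_pdivrMr //; lra.
  have : 1 * eta <= a.+1%:R * eta by rewrite ler_wpM2r // ler1n.
  have := ler_wpM2r (mulr_ge0 (ler0n R a.+1) eta0) K25.
  by lra.
have K' : 31 - 150 / b%:R <= K * (1 - eta) ^+ a.+1 * (1 - s%:R^-1) ^+ b.
  have s1 : 0 <= (s%:R^-1 : R) <= 1.
    rewrite invr_ge0 ltW //= invf_le1 //; nra.
  have e1 : 0 <= eta <= 1 by rewrite eta0 ltW.
  have := ler_wpM2l (ltW K0) (bernoulli_mul a.+1 b e1 s1).
  rewrite -mulrA; apply: le_trans.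
  (* The allowance 150/b is split into 106/b for the loss of density and 20/b for
     150/a and the losses due to distinctness. *)
  have t1 : 31 * (b%:R / s%:R) <= 106 / b%:R :> R.
    rewrite mulrA ler_pdivrMr // mulrAC ler_pdivlMr ?(lt_le_trans _ b25r) //.
    by nra.
  have t2 : (150 + (2 + 2 / 25)) / a%:R <= 20 / b%:R :> R.
    rewrite ler_pdivrMr // mulrAC ler_pdivlMr ?(lt_le_trans _ b25r) //.
    by nra.
  have t3 : K * (b%:R * s%:R^-1) <= 31 * (b%:R / s%:R).
    apply: ler_wpM2r; first by rewrite divr_ge0 // ltW.
    by rewrite /K gerBl divr_ge0.
  have bi : 0 < b%:R^-1 :> R by rewrite invr_gt0 (lt_le_trans _ b25r).
  by rewrite /K in t3 Keta *; lra.
have red : exists X' M (q' : R), ample e X' M l b q' (31 - 150 / b%:R) /\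
    (biclique e X' M l b -> biclique e X Y (s + l) b).
  apply: (@ample_reduce _ _ _ _ X Y s l b q K _ eta); rewrite ?las //.
  by rewrite lb (ltnW ba).
move: red; rewrite las => -[X' [M [q' [amp' red]]]].
apply: red; apply: biclique_flip.
exact: IH ba _ _ _ _ _ _ b25 (ample_flip amp').
Qed.

(** The first reduction, from exponents (t, t), is the only one that loses a
constant factor: (1 - 1/s)^t tends to 1/e, is never
below (84/100)^8 for t >= 125, and 128 (84/100)^8 > 31.7. *)
Lemma biclique_diag (R : realFieldType) (t : nat) (T1 T2 : finType)
    (e : T1 -> T2 -> bool) X Y (q : R) :
  (0 < t)%N -> ample e X Y t t q (128 : R) -> biclique e X Y t t.
Proof.
move=> t0 amp.
have p0 : 0 < 2 ^+ t :> R by rewrite exprn_gt0 // ltr0n.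
have [t124|t125] := leqP t 124.
  apply: (biclique_of_ample amp) => //.
  have small : 2 * t%:R ^+ 2 / 2 ^+ t <= 4 :> R.
    rewrite ler_pdivrMr //.
    have : t%:R ^+ 2 <= 2 * 2 ^+ t :> R.
      by have := sqr_le_pow2 t; rewrite -(ler_nat R) natrM !natrX.
    lra.
  have : t%:R <= 124 :> R by rewrite (ler_nat R t 124).
  lra.
set l := up_log 2 (t ^ 3).
have tl : (32 * l + 175 <= 7 * t)%N by apply: up_log_cube_affine.
have l_le : (l <= t)%N by clear -tl; lia.
(* Bernoulli is applied to k-th powers, k being t/8 rounded up, and the result
   is raised to the 8th power; k / s <= 16/100. *)
pose k := ((t + 7) %/ 8)%N.
have tk : (t <= 8 * k)%N by clear; rewrite /k; lia.
have ks : (25 * k <= 4 * (t - l))%N by clear -tl; rewrite /k; lia.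
have s1 : (1 < t - l)%N by clear -tl t125; lia.
set s := (t - l)%N in ks s1.
have las : (s + l)%N = t by rewrite subnK.
have t125r : 125 <= t%:R :> R by rewrite (ler_nat R 125).
pose eta : R := 2 * t%:R / (128 * 2 ^+ t).
have etaP : 2 * t%:R <= eta * (128 * 2 ^+ t).
  by rewrite /eta divfK // gt_eqF // mulr_gt0.
have eta0 : 0 <= eta by rewrite divr_ge0 ?mulr_ge0 // ltW.
have teta : t.+1%:R * eta <= 1 / 1000.
  have tp : t%:R ^+ 3 <= 2 ^+ t :> R.
    by rewrite -!natrX ler_nat; apply: cube_le_pow2; apply: leq_trans t125.
  rewrite /eta mulrA ler_pdivrMr ?mulr_gt0 // -natr1.
  have : 125 * t%:R ^+ 2 <= t%:R ^+ 3 :> R.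
    by rewrite [leRHS]exprS ler_wpM2r ?exprn_ge0.
  nra.
have eta1 : eta < 1.
  have : 1 * eta <= t.+1%:R * eta by rewrite ler_wpM2r // ler1n.
  lra.
have P1 : 1 - 1 / 1000 <= (1 - eta) ^+ t.+1.
  by apply: le_trans (bernoulli _ (ltW eta1)); lra.
have s0 : 0 < s%:R :> R by rewrite ltr0n ltnW.
have iv : 0 <= (s%:R^-1 : R) <= 1 by rewrite invr_ge0 ltW //= invf_le1 // ler1n ltnW.
have P2 : (84 / 100) ^+ 8 <= (1 - s%:R^-1) ^+ t :> R.
  apply: le_trans (_ : ((1 - s%:R^-1) ^+ k) ^+ 8 <= _).
    apply: lerXn2r; rewrite ?nnegrE ?exprn_ge0 //; [lra|lra|].
    have /andP[_ iv1] := iv.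
    apply: le_trans (bernoulli k iv1).
    have : k%:R * s%:R^-1 <= 16 / 100 :> R.
      rewrite ler_pdivrMr //.
      have : 25 * k%:R <= 4 * s%:R :> R by rewrite -!natrM ler_nat.
      lra.
    lra.
  by rewrite -exprM ler_wiXn2l //; [lra|lra|rewrite mulnC].
have K' : 31 - 150 / t%:R <= 128 * (1 - eta) ^+ t.+1 * (1 - s%:R^-1) ^+ t.
  have h1 : 0 <= 150 / t%:R :> R by rewrite divr_ge0.
  have h2 : 0 <= (84 / 100) ^+ 8 :> R by rewrite exprn_ge0 //; lra.
  apply: le_trans (_ : 128 * (1 - 1 / 1000) * (84 / 100) ^+ 8 <= _).
    by lra.
  by apply: ler_pM => //; lra.
have red : exists X' M (q' : R), ample e X' M l t q' (31 - 150 / t%:R) /\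
    (biclique e X' M l t -> biclique e X Y (s + l) t).
  apply: (@ample_reduce _ _ _ _ X Y s l t q 128 _ eta); rewrite ?las //.
  by rewrite l_le leqnn.
move: red; rewrite las => -[X' [M [q' [amp' red]]]].
apply: red; apply: biclique_flip.
by apply: biclique_up_log (ample_flip amp'); apply: leq_trans t125.
Qed.

(** * From the edge set to the bipartite count *)

Lemma card_edges_le (G : sgraph) (V1 V2 : {set G}) :
  bipartition V1 V2 ->
  (#|edges G| <= edge_count (@adj G) V1 V2)%N.
Proof.
case=> _ _ bip.
rewrite -edge_count_flip.
pose P := [set xy : G * G | [&& xy.1 \in V1, xy.2 \in V2 & adj xy.1 xy.2]].
have sub : edges G \subset [set [set xy.1; xy.2] | xy in P].
  apply/subsetP => E; rewrite inE => /existsP[x /existsP[y /andP[xy /eqP ->]]].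
  case/orP: (bip _ _ xy) => /andP[xV yV]; apply/imsetP.
    by exists (x, y); rewrite // inE xV yV.
  by exists (y, x); rewrite /= ?inE /= ?xV ?yV 1?adj_sym // setUC.
apply: leq_trans (subset_leq_card sub) _.
apply: leq_trans (leq_imset_card _ _) _.
rewrite -sum1_card (eq_bigl (fun xy : G * G => (xy.1 \in V1) &&
  (xy.2 \in [set y in V2 | adj xy.1 y]))); last first.
  by move=> xy; rewrite !inE.
rewrite -(pair_big_dep (mem V1)
  (fun x y => y \in [set y in V2 | adj x y]) (fun _ _ => 1%N)) /=.
by apply: leq_sum => x _; rewrite sum1_card.
Qed.

Unset Implicit Arguments.

Theorem theorem1p1 (R : realType) (t : nat) (p : R) (G : sgraph)
    (V1 V2 : {set G}) :
  (1 <= t)%N ->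
  0 < p -> p <= 1 / 2 ->
  bipartition V1 V2 ->
  p <= #|edges G|%:R / (#|V1|%:R * #|V2|%:R) ->
  128 * p ^- t <= Num.min #|V1|%:R #|V2|%:R ->
  contains_Ktt V1 V2 t.
Proof.
move=> t1 p0 p12 bip dens.
have pt0 : 0 < p ^+ t by rewrite exprn_gt0.
have K0 : 0 < 128 * p ^- t by rewrite mulr_gt0 // invr_gt0.
rewrite le_min => /andP[n1 n2].
have n10 := lt_le_trans K0 n1; have n20 := lt_le_trans K0 n2.
apply: (@biclique_diag R t _ _ (@adj G) V1 V2 p t1).
split.
- by rewrite p0.
- rewrite -mulrA; move: dens; rewrite ler_pdivlMr ?mulr_gt0 // => /le_trans.
  by apply; rewrite ler_nat card_edges_le.
- by rewrite -ler_pdivrMr.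
- by rewrite -ler_pdivrMr.
Qed.
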